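(* Let $G$ be a groupoid on a topological space $X$ and let $H\in L_G(X)$ be a wide subgroupoid of $G$. If $H$ has connected transitivity components, then $H=glob(loc(H))$. Conversely, if $H=glob(loc(H))$ and $H$ has closed transitivity components, then $H$ has connected transitivity components.
   Context: $X$ is a topological space and $G$ is a groupoid on $X$, i.e. an (abstract) groupoid with object set $X$. For an open set $U\subseteq X$, $G|U$ is the full subgroupoid of $G$ on the objects in $U$, and $L_G(U)$ is the set of all wide subgroupoids of $G|U$ (subgroupoids having all points of $U$ as objects). For $V\subseteq U$ open and $H\in L_G(U)$, $H|V\in L_G(V)$ is the full subgroupoid of $H$ on $V$; this makes $L_G$ a presheaf on $X$. Let $\mathcal{L}_G\to X$ be the associated sheaf (space of germs). The germ at $x\in U$ of $H\in L_G(U)$ is written $(U,H)_x$; thus $(U,H)_x=(V,K)_x$ iff $H|W=K|W$ for some open $W$ with $x\in W\subseteq U\cap V$. A local subgroupoid of $G$ is a global section $s:X\to\mathcal{L}_G$. Partial order: on germs at $x$, $(U',H')_x\leq(U,H)_x$ iff there is an open $W$ with $x\in W\subseteq U\cap U'$ and $H'|W$ a subgroupoid of $H|W$; for local subgroupoids, $s\leq t$ iff $s(x)\leq t(x)$ for all $x\in X$. For a wide subgroupoid $H$ of $G$, $loc(H)$ is the local subgroupoid $x\mapsto (X,H)_x$. For a local subgroupoid $s$ of $G$, $glob(s)$ is the wide subgroupoid of $G$ that is the intersection of all wide subgroupoids $K$ of $G$ with $s\leq loc(K)$. The transitivity component of $x$ in a groupoid $K$ on $X$ is the set of all $y\in X$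 such that $K(x,y)$, the set of morphisms of $K$ from $x$ to $y$, is non-empty. Connectedness and closedness of transitivity components refer to them as subspaces of $X$. *)

(* Defs.v *)
From HB Require Import structures.
From mathcomp Require Import all_boot all_order all_classical topology.

Set Implicit Arguments.
Unset Strict Implicit.
Unset Printing Implicit Defensive.

Local Open Scope classical_set_scope.
Local Open Scope quotient_scope.

(* An abstract groupoid with object set X. The composite of g : x -> y and
   h : y -> z is [gcomp g h], in diagrammatic order. *)
Record groupoid (X : Type) := Groupoid {
  hom :> X -> X -> Type;
  gid : forall x, hom x x;
  gcomp : forall x y z, hom x y -> hom y z -> hom x z;
  ginv : forall x y, hom x y -> hom y x;
  compA : forall x y z t (f : hom x y) (g : hom y z) (h : hom z t),
    gcomp f (gcomp g h) = gcomp (gcomp f g) h;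
  comp1g : forall x y (f : hom x y), gcomp (gid x) f = f;
  compg1 : forall x y (f : hom x y), gcomp f (gid y) = f;
  compgV : forall x y (f : hom x y), gcomp f (ginv f) = gid x;
  compVg : forall x y (f : hom x y), gcomp (ginv f) f = gid y }.

Arguments gid {X} _ _.

(* [wsub G U] is the set L_G(U) of wide subgroupoids of G|U. As G|U is full and
   the objects are exactly the points of U, such a subgroupoid is determined by
   its arrows, a family of sets of arrows of G with both end points in U. *)
Record wsub (X : Type) (G : groupoid X) (U : set X) := Wsub {
  arrows :> forall x y : X, set (G x y);
  arrows_ends : forall x y (g : G x y), arrows g -> U x /\ U y;
  arrows_id : forall x, U x -> arrows (gid G x);
  arrows_comp : forall x y z (g : G x y) (h : G y z),
    arrows g -> arrows h -> arrows (gcomp g h);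
  arrows_inv : forall x y (g : G x y), arrows g -> arrows (ginv g) }.

Section WideSubgroupoids.
Context {X : Type} {G : groupoid X}.

Lemma wsub_ext (U : set X) (H K : wsub G U) :
  (forall x y (g : G x y), H x y g <-> K x y g) -> H = K.
Proof.
case: H K => [a a1 a2 a3 a4] [b b1 b2 b3 b4] /= ab.
have e : a = b.
  apply: functional_extensionality_dep => x.
  apply: functional_extensionality_dep => y.
  by apply/seteqP; split=> g /ab.
by case: b / e b1 b2 b3 b4 {ab} => *; congr Wsub; exact: Prop_irrelevance.
Qed.

Definition subgpd_le (U : set X) (H K : wsub G U) : Prop :=
  forall x y (g : G x y), H x y g -> K x y g.

Section Restr.
Context {U V : set X} (VU : V `<=` U) (H : wsub G U).

Definition restr_arrows (x y : X) : set (G x y) :=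
  [set g | [/\ H x y g, V x & V y]].

Fact restr_ends x y (g : G x y) : restr_arrows g -> V x /\ V y.
Proof. by case. Qed.
Fact restr_gid x : V x -> restr_arrows (gid G x).
Proof. by move=> Vx; split=> //; apply: arrows_id; exact: VU. Qed.
Fact restr_mul x y z (g : G x y) (h : G y z) :
  restr_arrows g -> restr_arrows h -> restr_arrows (gcomp g h).
Proof. by move=> [Hg ? _] [Hh _ ?]; split=> //; exact: arrows_comp. Qed.
Fact restr_inv x y (g : G x y) : restr_arrows g -> restr_arrows (ginv g).
Proof. by move=> [Hg ? ?]; split=> //; exact: arrows_inv. Qed.

Definition restr : wsub G V := Wsub restr_ends restr_gid restr_mul restr_inv.

End Restr.

Lemma restr_id (U : set X) (UU : U `<=` U) (H : wsub G U) : restr UU H = H.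
Proof.
by apply: wsub_ext => x y g; split=> [[]|Hg] //; have [] := arrows_ends Hg.
Qed.

Lemma restr_comp (U V W : set X) (VU : V `<=` U) (WV : W `<=` V)
    (WU : W `<=` U) (H : wsub G U) : restr WV (restr VU H) = restr WU H.
Proof.
by apply: wsub_ext => x y g; split=> [[[? _ _] ? ?]|[? ? ?]]; split=> //;
  split=> //; exact: WV.
Qed.

Definition transitivity_component (K : wsub G setT) (x : X) : set X :=
  [set y | exists g : G x y, K x y g].

End WideSubgroupoids.

(* A representative (U, H) at x of a germ. *)
Record pregerm (X : topologicalType) (G : groupoid X) := Pregerm {
  pg_pt : X;
  pg_dom : set X;
  pg_open : open pg_dom;
  pg_in : pg_dom pg_pt;
  pg_sub : wsub G pg_dom }.

HB.instance Definition _ (X : topologicalType) (G : groupoid X) :=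
  gen_eqMixin (pregerm G).
HB.instance Definition _ (X : topologicalType) (G : groupoid X) :=
  gen_choiceMixin (pregerm G).

Section Germs.
Context {X : topologicalType} {G : groupoid X}.
Implicit Types p q r : pregerm G.

Definition pregerm_rel (R : forall W : set X, wsub G W -> wsub G W -> Prop)
    p q : Prop :=
  pg_pt p = pg_pt q /\
  exists (W : set X) (Wp : W `<=` pg_dom p) (Wq : W `<=` pg_dom q),
    [/\ open W, W (pg_pt p) & R W (restr Wp (pg_sub p)) (restr Wq (pg_sub q))].

Definition pregerm_eq := pregerm_rel (fun W => @eq (wsub G W)).
Definition pregerm_le := pregerm_rel (@subgpd_le X G).

Lemma pregerm_rel_trans (R : forall W : set X, wsub G W -> wsub G W -> Prop) :
  (forall W, Relation_Definitions.transitive _ (R W)) ->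
  (forall (V W : set X) (WV : W `<=` V) (H K : wsub G V), R V H K ->
    R W (restr WV H) (restr WV K)) ->
  forall p q r, pregerm_rel R p q -> pregerm_rel R q r -> pregerm_rel R p r.
Proof.
move=> Rtr Rres p q r [pq [V [Vp [Vq [oV xV E]]]]] [qr [W [Wq [Wr [oW xW F]]]]].
split; first by rewrite pq.
have IV : V `&` W `<=` V by move=> ? [].
have IW : V `&` W `<=` W by move=> ? [].
have Ip := subset_trans IV Vp; have Ir := subset_trans IW Wr.
exists (V `&` W), Ip, Ir; split; [exact: openI | by split=> //; rewrite pq |].
have Iq := subset_trans IV Vq.
move: (Rres _ _ IV _ _ E) (Rres _ _ IW _ _ F).
rewrite (restr_comp _ _ Ip) (restr_comp _ _ Iq) (restr_comp _ _ Iq).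
by rewrite (restr_comp _ _ Ir); exact: Rtr.
Qed.

Lemma pregerm_eq_refl p : pregerm_eq p p.
Proof.
split=> //; exists (pg_dom p), (@subset_refl _ _), (@subset_refl _ _).
by split=> //; [exact: pg_open | exact: pg_in].
Qed.

Lemma pregerm_eq_sym p q : pregerm_eq p q -> pregerm_eq q p.
Proof.
move=> [e [W [Wp [Wq [oW xW E]]]]]; split=> //.
by exists W, Wq, Wp; split=> //; rewrite -e.
Qed.

Lemma pregerm_eq_trans p q r :
  pregerm_eq p q -> pregerm_eq q r -> pregerm_eq p r.
Proof.
by apply: pregerm_rel_trans => [W ? ? ? -> //|V W WV H K ->].
Qed.

Lemma pregerm_le_trans p q r :
  pregerm_le p q -> pregerm_le q r -> pregerm_le p r.
Proof.
apply: pregerm_rel_trans => [W A B C AB BC x y g /AB/BC //|].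
by move=> V W WV H K HK x y g [/HK ? ? ?].
Qed.

Lemma pregerm_eq_le p q : pregerm_eq p q -> pregerm_le p q.
Proof.
move=> [e [W [Wp [Wq [oW xW E]]]]]; split=> //.
by exists W, Wp, Wq; split=> //; rewrite E => ? ?.
Qed.

Let eqb p q := `[< pregerm_eq p q >].

Fact pregerm_eqb_refl : ssrbool.reflexive eqb.
Proof. by move=> p; apply/asboolP; exact: pregerm_eq_refl. Qed.
Fact pregerm_eqb_sym : ssrbool.symmetric eqb.
Proof. by move=> p q; apply/asboolP/asboolP; exact: pregerm_eq_sym. Qed.
Fact pregerm_eqb_trans : ssrbool.transitive eqb.
Proof.
move=> q p r /asboolP pq /asboolP qr; apply/asboolP.
exact: pregerm_eq_trans pq qr.
Qed.

Definition pregerm_equiv : equiv_rel (pregerm G) :=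
  EquivRel eqb pregerm_eqb_refl pregerm_eqb_sym pregerm_eqb_trans.

End Germs.

(* The total space of the sheaf of germs of the presheaf L_G. *)
Definition germs (X : topologicalType) (G : groupoid X) : Type :=
  {eq_quot (@pregerm_equiv X G)}.

HB.instance Definition _ (X : topologicalType) (G : groupoid X) :=
  Choice.copy (germs G) {eq_quot (@pregerm_equiv X G)}.
HB.instance Definition _ (X : topologicalType) (G : groupoid X) :=
  EqQuotient.copy (germs G) {eq_quot (@pregerm_equiv X G)}.

Section SheafOfGerms.
Context {X : topologicalType} {G : groupoid X}.

(* The germ (U, H)_x. *)
Definition germ (x : X) (U : set X) (oU : open U) (Ux : U x) (H : wsub G U) :
  germs G := \pi_(germs G) (Pregerm oU Ux H).

Lemma pi_germ_eq (p q : pregerm G) :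
  \pi_(germs G) p = \pi_(germs G) q <-> pregerm_eq p q.
Proof. by split=> [/eqquotP/asboolP//|pq]; apply/eqquotP/asboolP. Qed.

Definition germ_pt (a : germs G) : X := pg_pt (repr a).

Lemma germ_ptE (x : X) (U : set X) (oU : open U) (Ux : U x) (H : wsub G U) :
  germ_pt (germ oU Ux H) = x.
Proof.
rewrite /germ_pt; set p := Pregerm oU Ux H.
by have /pi_germ_eq[] : \pi_(germs G) (repr (germ oU Ux H)) = \pi p
  by rewrite reprK.
Qed.

Definition germ_le (a b : germs G) : Prop := pregerm_le (repr a) (repr b).

Lemma germ_leE (p q : pregerm G) :
  germ_le (\pi_(germs G) p) (\pi_(germs G) q) <-> pregerm_le p q.
Proof.
have e r : pregerm_eq (repr (\pi_(germs G) r)) r.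
  by apply/pi_germ_eq; rewrite reprK.
have e' r : pregerm_eq r (repr (\pi_(germs G) r)) by exact: pregerm_eq_sym.
split=> pq.
  exact: pregerm_le_trans (pregerm_eq_le (e' p))
    (pregerm_le_trans pq (pregerm_eq_le (e q))).
exact: pregerm_le_trans (pregerm_eq_le (e p))
  (pregerm_le_trans pq (pregerm_eq_le (e' q))).
Qed.

(* {(U, H)_y | y in U}; these sets form a base of the topology of the space of
   germs. *)
Definition germ_base (U : set X) (oU : open U) (H : wsub G U) :
  set (germs G) := [set a | exists (y : X) (Uy : U y), a = germ oU Uy H].

Definition germs_open (A : set (germs G)) : Prop :=
  forall a, A a -> exists (U : set X) (oU : open U) (H : wsub G U),
    germ_base oU H a /\ germ_base oU H `<=` A.

Lemma germs_ind (P : germs G -> Prop) :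
  (forall x (U : set X) (oU : open U) (Ux : U x) (H : wsub G U),
    P (germ oU Ux H)) -> forall a, P a.
Proof.
by move=> Pg a; rewrite -[a]reprK; case: (repr a) => x U oU Ux H; exact: Pg.
Qed.

Fact germs_openT : germs_open setT.
Proof. by elim/germs_ind=> x U oU Ux H _; exists U, oU, H; split=> //; exists x, Ux. Qed.

Fact germs_openI : setI_closed germs_open.
Proof.
move=> A B oA oB a [Aa Ba].
have [U [oU [H [[x [Ux aH]] sA]]]] := oA _ Aa.
have [V [oV [K [[y [Vy aK]] sB]]]] := oB _ Ba.
have /pi_germ_eq[/= xy [W [/= WU [WV [oW Wx HK]]]]] : germ oU Ux H = germ oV Vy K.
  by rewrite -aH.
have resE z (Wz : W z) Z (oZ : open Z) (WZ : W `<=` Z) (L : wsub G Z) (Zz : Z z) :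
    germ oW Wz (restr WZ L) = germ oZ Zz L.
  apply/pi_germ_eq; split=> //=.
  exists W, (@subset_refl _ W), WZ; split=> //=.
  by rewrite restr_id.
exists W, oW, (restr WU H); split.
  by exists x, Wx; rewrite aH (resE _ _ _ oU _ _ Ux).
move=> _ [z [Wz ->]]; split.
  by apply: sA; exists z, (WU _ Wz); exact: resE.
by apply: sB; exists z, (WV _ Wz); rewrite HK; exact: resE.
Qed.

Fact germs_open_bigU (I : Type) (f : I -> set (germs G)) :
  (forall i, germs_open (f i)) -> germs_open (\bigcup_i f i).
Proof.
move=> of_ a [i _ /of_[U [oU [H [Ha sH]]]]].
by exists U, oU, H; split=> // b /sH; exists i.
Qed.

HB.instance Definition _ := isOpenTopological.Build (germs G)
  germs_openT germs_openI germs_open_bigU.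

End SheafOfGerms.

Record local_subgroupoid (X : topologicalType) (G : groupoid X) := LocalSub {
  lsec :> X -> germs G;
  lsec_pt : forall x, germ_pt (lsec x) = x;
  lsec_cts : continuous lsec }.

Section LocGlob.
Context {X : topologicalType} {G : groupoid X}.

Definition local_le (s t : local_subgroupoid G) : Prop :=
  forall x, germ_le (s x) (t x).

Definition loc_fun (H : wsub G setT) (x : X) : germs G :=
  germ openT (I : setT x) H.

Fact loc_fun_pt (H : wsub G setT) x : germ_pt (loc_fun H x) = x.
Proof. exact: germ_ptE. Qed.

Fact loc_fun_cts (H : wsub G setT) : continuous (loc_fun H).
Proof.
apply/continuousP => A oA; rewrite openE => x /= Ax.
have [U [oU [K [[y [Uy]]]]]] := oA _ Ax.
move=> /pi_germ_eq[/= _ [W [/= WT [WU [oW Wx HK]]]]] sA.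
rewrite /interior nbhsE; exists W => // z Wz /=; apply: sA.
exists z, (WU _ Wz); apply/pi_germ_eq; split=> //=.
by exists W, WT, WU.
Qed.

Definition loc (H : wsub G setT) : local_subgroupoid G :=
  LocalSub (loc_fun_pt H) (@loc_fun_cts H).

Section Glob.
Context (s : local_subgroupoid G).

Definition glob_arrows (x y : X) : set (G x y) :=
  [set g | forall K : wsub G setT, local_le s (loc K) -> K x y g].

Fact glob_ends x y (g : G x y) : glob_arrows g -> setT x /\ setT y.
Proof. by []. Qed.
Fact glob_gid x : setT x -> glob_arrows (gid G x).
Proof. by move=> _ K _; exact: arrows_id. Qed.
Fact glob_mul x y z (g : G x y) (h : G y z) :
  glob_arrows g -> glob_arrows h -> glob_arrows (gcomp g h).
Proof. by move=> sg sh K sK; apply: arrows_comp; [exact: sg|exact: sh]. Qed.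
Fact glob_inv x y (g : G x y) : glob_arrows g -> glob_arrows (ginv g).
Proof. by move=> sg K sK; apply: arrows_inv; exact: sg. Qed.

Definition glob : wsub G setT := Wsub glob_ends glob_gid glob_mul glob_inv.

End Glob.

End LocGlob.

(* Main.v *)
Require Import Defs.
From HB Require Import structures.
From mathcomp Require Import all_boot all_order all_classical topology.

(** Both halves rest on one reformulation: [H = glob (loc H)] says that [H] is
    contained in every wide subgroupoid [K] that contains it locally, meaning
    that each point has an open neighbourhood [W] with [H|W] inside [K|W].

    Suppose the components of [H] are connected and [H] is locally in [K]. Fix
    [x] with component [C], and consider the points [y] of [C] for which [K]
    contains all of [H(x, y)]. Near any point of [C], arrows of [H] are arrows
    of [K], so composing with short arrows of [H] carries this property from a
    point of [C] to all nearby points of [C], and back. The set of such points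
    is therefore clopen in [C]; it contains [x], so it is [C].

    Conversely, if a component [C] of [H] splits into two nonempty relatively
    closed pieces [A] and [B], cut [H] along [A]: keep only those arrows of [H]
    whose two ends are both in [A] or both outside it. As [C] is closed, [A] and
    [B] are closed in [X], so each point has a neighbourhood that misses one of
    them, on which no arrow of [H] is lost. Hence the cut contains [H] locally,
    yet it lacks every arrow of [H] from [A] to [B], and such arrows exist
    because [C] is a single component. *)

Local Open Scope classical_set_scope.

Section LocallyContained.
Context {X : topologicalType} {G : groupoid X}.
Implicit Types H K : wsub G setT.

Lemma local_le_locP H K :
  local_le (loc H) (loc K) <->
  forall x, exists2 W : set X, open_nbhs x W &
    forall y z (g : G y z), W y -> W z -> H y z g -> K y z g.
Proof.
split=> HK x.
  have /germ_leE[/= _ [W [WT [WT' [/= oW Wx le]]]]] := HK x.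
  exists W => // y z g Wy Wz Hg.
  by have [] : restr WT' K y z g by apply: le.
have [W [oW Wx] le] := HK x; apply/germ_leE; split=> //=.
exists W, (@subsetT _ W), (@subsetT _ W); split=> // y z g [/= Hg Wy Wz].
by split=> //; exact: le.
Qed.

Lemma eq_glob_locP H :
  H = glob (loc H) <->
  forall K, local_le (loc H) (loc K) -> subgpd_le H K.
Proof.
split=> [HE K HK x y g|min].
  by rewrite HE => /(_ K HK).
apply: wsub_ext => x y g; split=> [Hg K /min|]; first exact.
by apply; apply/local_le_locP => z; exists setT => //; split=> //; exact: openT.
Qed.

(** Fix [h] in [H(x, y)]. Any [g] in [H(x, z)] factors through [y] as
    [h (h^-1 g)], where [h^-1 g] is an arrow of [H] with both ends in [W]. *)
Lemma homset_sub_transport {H K} {W : set X} {x y z : X} :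
  (forall y z (g : G y z), W y -> W z -> H y z g -> K y z g) ->
  W y -> W z -> transitivity_component H x y ->
  H x y `<=` K x y -> H x z `<=` K x z.
Proof.
move=> HK Wy Wz [h Hh] HKy g Hg.
rewrite -[g]comp1g -(compgV h) -Defs.compA.
apply: arrows_comp; first exact: HKy.
by apply: HK => //; apply: arrows_comp => //; exact: arrows_inv.
Qed.

Lemma subgpd_le_of_connected H K :
  (forall x, connected (transitivity_component H x)) ->
  local_le (loc H) (loc K) -> subgpd_le H K.
Proof.
move=> cH /local_le_locP HK x y g Hg.
set C := transitivity_component H x; pose S := [set z | H x z `<=` K x z].
suff CS : C `&` S = C.
  have [_ Sy] : (C `&` S) y by rewrite CS; exists g.
  exact: Sy.
have near_iff z : C z ->
    exists2 W, open_nbhs z W & forall t, W t -> C t -> (S z <-> S t).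
  move=> Cz; have [W [oW Wz] le] := HK z; exists W => // t Wt Ct.
  split; first exact: (homset_sub_transport le Wz).
  exact: (homset_sub_transport le Wt).
apply: cH.
- exists x; split; first by exists (gid G x); exact: arrows_id.
  by have [W [_ Wx] le] := HK x => h; exact: le.
- (* Points off [C] lie in [S] vacuously, so a neighbourhood only has to be
     checked on [C]. *)
  exists S^°; first exact: open_interior.
  apply/seteqP; split=> z [Cz Sz]; split=> //; last exact: interior_subset Sz.
  have [W [oW Wz] e] := near_iff z Cz; rewrite /interior nbhsE /=.
  exists W; first by split.
  move=> t Wt; have [Ct|nCt] := pselect (C t); first exact/(e t).
  by move=> h Hh; case: nCt; exists h.
- exists (closure (C `&` S)); first exact: closed_closure.
  apply/seteqP; split=> z [Cz Sz]; split=> //.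
    by apply: subset_closure.
  have [W [oW Wz] e] := near_iff z Cz.
  have [|t [[Ct St] Wt]] := Sz W; first exact: open_nbhs_nbhs.
  exact/(e t).
Qed.

End LocallyContained.

Section Cut.
Context {X : Type} {G : groupoid X} {U : set X}.
Context (H : wsub G U) (A : set X).

Definition cut_arrows (x y : X) : set (G x y) :=
  [set g | H x y g /\ (A x <-> A y)].

Fact cut_ends x y (g : G x y) : cut_arrows x y g -> U x /\ U y.
Proof. by move=> [Hg _]; exact: arrows_ends Hg. Qed.
Fact cut_gid x : U x -> cut_arrows x x (gid G x).
Proof. by move=> Ux; split=> //; exact: arrows_id. Qed.
Fact cut_mul x y z (g : G x y) (h : G y z) :
  cut_arrows x y g -> cut_arrows y z h ->
  cut_arrows x z (gcomp g h).
Proof.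
by move=> [Hg xy] [Hh yz]; split; [exact: arrows_comp|rewrite xy].
Qed.
Fact cut_inv x y (g : G x y) :
  cut_arrows x y g -> cut_arrows y x (ginv g).
Proof. by move=> [Hg xy]; split; [exact: arrows_inv|rewrite xy]. Qed.

Definition cut : wsub G U := Wsub cut_ends cut_gid cut_mul cut_inv.

End Cut.

(** A neighbourhood that misses [A] contains no arrow meeting [A]; one that
    misses [B] contains no arrow joining [A] to its complement, because such an
    arrow can only leave [A] into [B]. *)
Lemma local_le_loc_cut (X : topologicalType) (G : groupoid X)
    (H : wsub G setT) (A B : set X) :
  closed A -> closed B -> A `&` B = set0 ->
  (forall x y (g : G x y), H x y g -> A x -> (A `|` B) y) ->
  local_le (loc H) (loc (cut H A)).
Proof.
move=> cA cB AB sat; apply/local_le_locP => x.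
have [Ax|nAx] := pselect (A x).
  exists (~` B).
    split; [exact: closed_openC|move=> Bx].
    by have : (A `&` B) x by []; rewrite AB.
  move=> y z g nBy nBz Hg; split=> //; split=> [Ay|Az].
    by case: (sat _ _ _ Hg Ay).
  by case: (sat _ _ _ (arrows_inv Hg) Az).
exists (~` A); first by split=> //; exact: closed_openC.
by move=> y z g nAy nAz Hg; split.
Qed.

Lemma connected_of_eq_glob_loc (X : topologicalType) (G : groupoid X)
    (H : wsub G setT) (x : X) :
  H = glob (loc H) -> closed (transitivity_component H x) ->
  connected (transitivity_component H x).
Proof.
move=> /eq_glob_locP min; set C := transitivity_component H x => cC.
move=> A [a Aa] [O oO AO] [F cF AF].
have sAC : A `<=` C by rewrite AO => ? [].
apply/seteqP; split=> // b Cb.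
have [g Hg] : transitivity_component H a b.
  have [[h Hh] [k Hk]] := (sAC _ Aa, Cb).
  by exists (gcomp (ginv h) k); apply: arrows_comp => //;
    exact: arrows_inv.
suff : local_le (loc H) (loc (cut H A)) by move=> /min/(_ _ _ _ Hg)[_ <-].
apply: (@local_le_loc_cut _ _ _ _ (C `&` ~` O)).
- by rewrite AF; exact: closedI.
- by apply: closedI => //; exact: open_closedC.
- by rewrite AO; apply/seteqP; split=> // t [[_ Ot] [_]].
- move=> y z h Hh /sAC[k Hk].
  have Cz : C z by exists (gcomp k h); exact: arrows_comp.
  by have [Oz|nOz] := pselect (O z); [left; rewrite AO|right].
Qed.

Theorem theorem2p10 (X : topologicalType) (G : groupoid X) (H : wsub G setT) :
  ((forall x : X, connected (transitivity_component H x)) -> H = glob (loc H)) /\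
  (H = glob (loc H) ->
   (forall x : X, closed (transitivity_component H x)) ->
   forall x : X, connected (transitivity_component H x)).
Proof.
split=> [cH|HE cH x]; last exact: connected_of_eq_glob_loc.
by apply/eq_glob_locP => K; exact: subgpd_le_of_connected.
Qed.
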